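(* Let $M$ be an atomic monoid whose set of atoms $H$ admits a stratification $H=H_1\cup H_2\cup\dots\cup H_k$, and put $M_i=\langle H_i\cup\dots\cup H_k\rangle$ for $i\in\{1,\dots,k\}$. Then each $x\in M$ has a representation of the form $x=h_1+h_2+\dots+h_k$ such that (1) $h_i\in\langle H_i\rangle$ for all $i\in\{1,\dots,k\}$, (2) $h_i+\dots+h_k\in\operatorname{Ap}(M,H_1\cup\dots\cup H_{i-1})$ for all $i\in\{2,\dots,k\}$. If in addition, for each $i\in\{1,\dots,k\}$, for every $q,q'\in H_i$ with $q\ne q'$, $q$ is coprime with $q'$ in the monoid $M_i$, then for each $x\in M$ the representation $x=h_1+h_2+\dots+h_k$ with $h_i\in\langle H_i\rangle$ for all $i\in\{1,\dots,k\}$ and $h_i+\dots+h_k\in\operatorname{Ap}(M,H_1\cup\dots\cup H_{i-1})$ for all $i\in\{2,\dots,k\}$ is unique.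
   Context: All monoids are additive, commutative, cancellative and reduced (the only unit is $0$). $\mathbb N$ denotes the nonnegative integers. For $a,b\in M$, $a\le_M b$ means $b-a\in M$, i.e. $b=a+c$ for some $c\in M$. An atom of $M$ is a nonzero element that is not a sum of two nonzero elements of $M$; $M$ is atomic if every element is a finite sum of atoms. A monoid is factorial if every element is a sum of atoms in a unique way up to order. $\langle X\rangle$ is the submonoid generated by $X$. For $X\subseteq M$, $\operatorname{Ap}(M,X)=M\setminus(X+M)$. A non-empty subset $Q$ of a monoid $M$ is linked to $M$ if for each $x\in M\setminus\{0\}$ there exists $c(x)\in\mathbb N$ such that whenever $\sum_{q\in Q}\lambda_q q\le_M x$ with $\lambda_q\in\mathbb N$ (all but finitely many zero), one has $\sum_{q\in Q}\lambda_q\le c(x)$. A stratification of the set of atoms $H$ of an atomic monoid $M$ is a partition $H=H_1\cup\dots\cup H_k$, $k\ge1$, such that for all $i\in\{1,\dots,k\}$ the monoid $\langle H_i\rangle$ is factorial, and the set $H_i$ is linked to the monoid $M_i=\langle H_i\cup\dots\cup H_k\rangle$. For a monoid $N$ and $x,y\in N$, $x$ is coprime with $y$ in $N$ if $x\not\le_N y$ and, whenever $x\le_N m+y$ for some $m\in N$, one has $x\le_N m$. *)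

(* Defs.v *)
From HB Require Import structures.
From mathcomp Require Import all_boot all_algebra finmap.
From mathcomp Require Import boolp classical_sets.

Set Implicit Arguments.
Unset Strict Implicit.
Unset Printing Implicit Defensive.

Import GRing.Theory.

Local Open Scope classical_set_scope.
Local Open Scope ring_scope.

(* The ambient monoid is an M : nmodType; the notions that
   apply both to M and to its submonoids are relative to a subset N : set M,
   and M itself is [set: M]. *)

Definition cancellative (M : nmodType) : Prop :=
  forall a b c : M, a + b = a + c -> b = c.

Definition reduced (M : nmodType) : Prop :=
  forall a b : M, a + b = 0 -> a = 0.

Definition is_submonoid (M : nmodType) (N : set M) : Prop :=
  N 0 /\ forall a b : M, N a -> N b -> N (a + b).

Definition gen (M : nmodType) (X : set M) : set M :=
  smallest (@is_submonoid M) X.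

Definition le_in (M : nmodType) (N : set M) (a b : M) : Prop :=
  exists2 c : M, N c & b = a + c.

Definition atoms (M : nmodType) (N : set M) : set M :=
  [set a | [/\ N a, a <> 0 &
    ~ exists b c : M, [/\ N b, N c, b <> 0, c <> 0 & a = b + c]]].

Definition atom_sum (M : nmodType) (N : set M) (x : M) (s : seq M) : Prop :=
  (forall a, a \in s -> atoms N a) /\ x = \sum_(a <- s) a.

Definition atomic (M : nmodType) (N : set M) : Prop :=
  forall x : M, N x -> exists s : seq M, atom_sum N x s.

Definition factorial_monoid (M : nmodType) (N : set M) : Prop :=
  forall x : M, N x ->
    (exists s : seq M, atom_sum N x s) /\
    (forall s t : seq M, atom_sum N x s -> atom_sum N x t -> perm_eq s t).

Definition Apery (M : nmodType) (N X : set M) : set M :=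
  N `\` [set a + m | a in X & m in N].

Definition linked (M : nmodType) (Q N : set M) : Prop :=
  [/\ Q !=set0, Q `<=` N &
    forall x : M, N x -> x <> 0 -> exists c : nat,
      forall l : {fsfun M -> nat with 0%N},
        (forall q : M, q \in finsupp l -> Q q) ->
        le_in N (\sum_(q <- finsupp l) q *+ l q) x ->
        (\sum_(q <- finsupp l) l q <= c)%N].

(* The indices 1..k are represented by 'I_k, that is, shifted to 0..k-1. *)
Definition tail_monoid (M : nmodType) (k : nat) (H : 'I_k -> set M) (i : 'I_k)
    : set M :=
  gen (\bigcup_(j in [set j : 'I_k | (i <= j)%N]) H j).

Definition stratification (M : nmodType) (k : nat) (H : 'I_k -> set M) : Prop :=
  [/\ (0 < k)%N, partition [set: 'I_k] H (atoms [set: M]) &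
    forall i : 'I_k,
      factorial_monoid (gen (H i)) /\ linked (H i) (tail_monoid H i)].

Definition coprime_in (M : nmodType) (N : set M) (x y : M) : Prop :=
  ~ le_in N x y /\ forall m : M, N m -> le_in N x (m + y) -> le_in N x m.

Definition strat_repr (M : nmodType) (k : nat) (H : 'I_k -> set M) (x : M)
    (h : {ffun 'I_k -> M}) : Prop :=
  [/\ x = \sum_(i < k) h i,
      forall i : 'I_k, gen (H i) (h i) &
      forall i : 'I_k, (0 < i)%N ->
        Apery [set: M] (\bigcup_(j in [set j : 'I_k | (j < i)%N]) H j)
          (\sum_(j < k | (i <= j)%N) h j)].

(* Main.v *)
Require Import Defs.
From mathcomp Require Import all_boot all_algebra finmap.
From mathcomp Require Import boolp classical_sets.

(** Existence is a greedy choice.  Starting from [x], split off the longest sum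
    of elements of [H_1] below [x], then the longest sum of elements of [H_2]
    below the remainder, and so on.  A longest sum exists because [H_i] is
    linked to [M_i], provided that the current remainder lies in [M_i]
    ([splitting]).  It does: a remainder from which no element of
    [H_1, ..., H_(i-1)] can be subtracted is a sum of atoms none of which lies
    in these strata ([avoids_tail_monoid]).  After the last stratum no atom can
    be subtracted, so the remainder is [0].

    For uniqueness, compare two representations stratum by stratum.  If
    [h_i + y = h'_i + y'] with no element of [H_i] below [y] or [y'], then every
    atom [q] of [h_i] occurs in [h'_i]: otherwise coprimality with the atoms of
    [h'_i] would push [q] below [y'].  Cancelling [q] and iterating gives
    [h_i = h'_i] and [y = y'] ([cancel_sums]). *)

Set Implicit Arguments.
Unset Strict Implicit.
Unset Printing Implicit Defensive.

Import GRing.Theory.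

Local Open Scope classical_set_scope.
Local Open Scope ring_scope.

(** * Generated submonoids and linked sets *)

Lemma gen_submonoid (M : nmodType) (X : set M) : is_submonoid (gen X).
Proof.
split=> [N [[N0 _] _] // | a b Xa Xb N NX].
by have [[_ ND] _] := NX; apply: ND; [exact: Xa | exact: Xb].
Qed.

Lemma sub_gen (M : nmodType) (X : set M) : X `<=` gen X.
Proof. by move=> x Xx N [_ XN]; apply: XN. Qed.

Lemma gen_sum (M : nmodType) (X : set M) (s : seq M) :
  (forall a, a \in s -> gen X a) -> gen X (\sum_(a <- s) a).
Proof.
have [X0 XD] := gen_submonoid X.
move=> sX; rewrite big_seq; exact: (big_ind (gen X)).
Qed.

Lemma gen_seq (M : nmodType) (X : set M) (x : M) :
  gen X x -> exists2 s : seq M, (forall a, a \in s -> X a) & x = \sum_(a <- s) a.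
Proof.
pose N : set M :=
  [set y | exists2 s : seq M, (forall a, a \in s -> X a) & y = \sum_(a <- s) a].
move=> /(_ N); apply; split; last first.
  by move=> a Xa; exists [:: a]; rewrite ?big_seq1 // => b /[!inE] /eqP->.
split; first by exists [::]; rewrite ?big_nil.
move=> _ _ [s sX ->] [t tX ->]; exists (s ++ t); last by rewrite big_cat.
by move=> a; rewrite mem_cat => /orP[/sX|/tX].
Qed.

(** The multiplicities in a list form a finitely supported family of
    coefficients, so that linkedness bounds the lengths of lists. *)
Lemma linked_size (M : nmodType) (Q N : set M) (x : M) :
  linked Q N -> N x -> x <> 0 ->
  exists c : nat, forall s : seq M, (forall q, q \in s -> Q q) ->
    le_in N (\sum_(q <- s) q) x -> (size s <= c)%N.
Proof.
move=> [_ _ linkQ] Nx x0; have [c cP] := linkQ x Nx x0; exists c => s sQ sx.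
pose l : {fsfun M -> nat with 0%N} :=
  [fsfun q in [fset q in s]%fset => count_mem q s | 0%N].
have lE q : l q = count_mem q s.
  rewrite fsfunE inE; case: ifP => // /negbT qs.
  by apply/esym/eqP; rewrite -leqn0 leqNgt -has_count has_pred1.
have mem_l q : (q \in finsupp l) = (q \in s).
  by rewrite mem_finsupp lE -lt0n -has_count has_pred1.
have perm_l : perm_eq (finsupp l) (undup s).
  by apply: uniq_perm; rewrite ?undup_uniq ?fset_uniq // => q; rewrite mem_undup mem_l.
have -> : size s = (\sum_(q <- finsupp l) l q)%N.
  rewrite (perm_big _ perm_l) /= -sum1_size -big_undup_iterop_count /=.
  by apply: eq_bigr => q _; rewrite lE Monoid.iteropE iter_addn_0 mul1n.
apply: cP => [q|]; first by rewrite mem_l => /sQ.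
rewrite (perm_big _ perm_l) /=.
suff -> : \sum_(q <- undup s) q *+ l q = \sum_(q <- s) q by [].
rewrite -[RHS]big_undup_iterop_count /=; apply: eq_bigr => q _.
by rewrite lE.
Qed.

(** * Elements below which lies no atom of the first strata *)

(** The condition [y \in Ap(M, H_1 \cup ... \cup H_n)], for a natural number
    [n] rather than an index, so that [n = 0] and [n = k] make sense in
    inductions over the strata. *)
Definition avoids (M : nmodType) (k : nat) (H : 'I_k -> set M) (n : nat)
    (y : M) : Prop :=
  forall (j : 'I_k) (q m : M), (j < n)%N -> H j q -> y <> q + m.

Lemma Apery_avoids (M : nmodType) (k : nat) (H : 'I_k -> set M) (n : nat)
    (y : M) :
  Apery [set: M] (\bigcup_(j in [set j : 'I_k | (j < n)%N]) H j) y
  <-> avoids H n y.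
Proof.
split=> [[_ yA] j q m jn Hq yE | yA].
  by apply: yA; exists q; [exists j | exists m].
by split=> // -[q [j jn Hq] [m _ /esym]]; apply: yA Hq.
Qed.

Lemma avoids_addr (M : nmodType) (k : nat) (H : 'I_k -> set M) (n : nat)
    (y z : M) : avoids H n (y + z) -> avoids H n z.
Proof. by move=> yzA j q m jn Hq zE; apply: (yzA j q (y + m) jn Hq); rewrite zE addrCA. Qed.

Section Strata.

Variables (M : nmodType) (k : nat) (H : 'I_k -> set M).
Hypotheses (cancelM : cancellative M) (reducedM : reduced M).
Hypotheses (atomicM : atomic [set: M]) (stratH : stratification H).

Lemma stratum_atom (j : 'I_k) (q : M) : H j q -> q <> 0.
Proof.
have [_ [HE _ _] _] := stratH; move=> Hq.
have : cover [set: 'I_k] H q by exists j.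
by rewrite HE => -[_ q0 _].
Qed.

Lemma avoids0 (n : nat) : avoids H n 0.
Proof. by move=> j q m _ Hq /esym/reducedM; apply: stratum_atom Hq. Qed.

Lemma avoids_atoms (n : nat) (y : M) : avoids H n y ->
  exists2 s : seq M, y = \sum_(a <- s) a &
    forall a, a \in s -> exists2 j : 'I_k, (n <= j)%N & H j a.
Proof.
have [_ [HE _ _] _] := stratH; move=> yA.
have [s [s_atoms yE]] := @atomicM y I; exists s => // a a_s.
have := s_atoms a a_s; rewrite -HE => -[j _ Hja].
exists j => //; rewrite leqNgt; apply/negP => jn.
by apply: (yA j a (\sum_(b <- rem a s) b)) => //; rewrite yE (big_rem a).
Qed.

(** The remainders of the greedy process stay in [M_i], the monoid in which
    linkedness and coprimality are available. *)
Lemma avoids_tail_monoid (i : 'I_k) (y : M) :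
  avoids H i y -> tail_monoid H i y.
Proof.
move=> /avoids_atoms[s -> sP]; apply: gen_sum => a /sP[j ij Hja].
by apply: sub_gen; exists j.
Qed.

Lemma avoids_all (y : M) : avoids H k y -> y = 0.
Proof.
move=> /avoids_atoms[[|a s] ->]; first by rewrite big_nil.
by move=> /(_ a (mem_head _ _))[j]; rewrite leqNgt ltn_ord.
Qed.

(** * Existence *)

(** One greedy step: the part split off is a sum of elements of [H i] of
    maximal length, so that no further element of [H i] can be subtracted. *)
Lemma splitting (i : 'I_k) (y : M) : avoids H i y ->
  exists h z : M, [/\ gen (H i) h, y = h + z & avoids H i.+1 z].
Proof.
move=> yA; have [y0 | y0] := pselect (y = 0).
  exists 0, 0; rewrite addr0; split=> //; last exact: avoids0.
  exact: (gen_submonoid _).1.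
have [_ _ /(_ i)[_ linkH]] := stratH.
have [c cP] := linked_size linkH (avoids_tail_monoid yA) y0.
pose P n := `[< exists s z, [/\ size s = n, forall q, q \in s -> H i q &
                               y = \sum_(q <- s) q + z] >].
have exP : exists n, P n.
  by exists 0%N; apply/asboolP; exists [::], y; rewrite big_nil add0r.
have leP n : P n -> (n <= c)%N.
  move=> /asboolP[s [z [<- sH yE]]]; apply: cP => //; exists z => //.
  by apply: avoids_tail_monoid; move: yA; rewrite yE; apply: avoids_addr.
case: (ex_maxnP exP leP) => n /asboolP[s [z [sn sH yE]]] maxn.
exists (\sum_(q <- s) q), z; split=> //.
  by apply: gen_sum => q /sH; apply: sub_gen.
move=> j q m; rewrite ltnS leq_eqVlt => /orP[/eqP/val_inj-> Hq zE|ji Hq].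
  (* An element [q] of [H i] below [z] would prolong the longest list [s]. *)
  suff /maxn : P n.+1 by rewrite ltnn.
  apply/asboolP; exists (q :: s), m; split=> /=; first by rewrite sn.
    by move=> r /[!inE] /orP[/eqP-> //|/sH].
  by rewrite yE zE big_cons addrCA addrA.
by apply: (@avoids_addr _ _ _ i (\sum_(q <- s) q)) Hq => //; rewrite -yE.
Qed.

Lemma sum_tail (h : 'I_k -> M) (i : 'I_k) :
  \sum_(j < k | (i <= j)%N) h j = h i + \sum_(j < k | (i < j)%N) h j.
Proof.
rewrite (bigD1 i) //=; congr (_ + _); apply: eq_bigl => j.
by rewrite ltn_neqAle andbC eq_sym.
Qed.

(** The greedy process started at stratum [n], by induction on the number
    [k - n] of strata left.  The splitting of stratum [n] does not change the
    tails beyond [n], and the tail from [n] is [y] itself, so every tail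
    inherits the Apery condition. *)
Lemma strat_repr_from (n : nat) (y : M) : (n <= k)%N -> avoids H n y ->
  exists h : {ffun 'I_k -> M},
    [/\ y = \sum_(j < k | (n <= j)%N) h j, forall j, gen (H j) (h j) &
        forall m, (n <= m)%N -> avoids H m (\sum_(j < k | (m <= j)%N) h j)].
Proof.
move=> /subnKC; move: (k - n)%N => d; elim: d => [|d IHd] in n y *.
  rewrite addn0 => -> /avoids_all->; exists [ffun=> 0].
  have sum0 m : \sum_(j < k | (m <= j)%N) [ffun=> 0] j = 0 :> M.
    by apply: big1 => j _; rewrite ffunE.
  split=> [|j|m _]; rewrite ?sum0 ?ffunE //; last exact: avoids0.
  exact: (gen_submonoid _).1.
rewrite addnS -addSn => nk yA.
have ltnk : (n < k)%N by rewrite -nk leq_addr.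
pose i := Ordinal ltnk.
have [h0 [z [Hh0 yE zA]]] := @splitting i y yA.
have [h [zE Hh hA]] := IHd _ _ nk zA.
pose h' := [ffun j => if j == i then h0 else h j].
have sumE m : (n < m)%N ->
    \sum_(j < k | (m <= j)%N) h' j = \sum_(j < k | (m <= j)%N) h j.
  move=> nm; apply: eq_bigr => j mj; rewrite ffunE; case: eqP => // ji.
  by move: mj; rewrite ji leqNgt nm.
have yE' : y = \sum_(j < k | (n <= j)%N) h' j.
  by rewrite (sum_tail h' i) sumE // -zE ffunE eqxx.
exists h'; split=> // [j|m]; first by rewrite ffunE; case: eqP => [->|].
rewrite leq_eqVlt => /orP[/eqP<-|nm]; first by rewrite -yE'.
by rewrite sumE //; apply: hA.
Qed.

Lemma strat_repr_exists (x : M) :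
  exists h : {ffun 'I_k -> M}, strat_repr H x h.
Proof.
have x_avoids : avoids H 0 x by [].
have [h [xE Hh hA]] := strat_repr_from (leq0n k) x_avoids.
by exists h; split=> // i _; apply/Apery_avoids/hA.
Qed.

(** * Uniqueness *)

(** For [n >= k] the tail is [0].  This case is what lets the comparison of the
    last components follow the same argument as the others. *)
Lemma strat_repr_avoids (x : M) (h : {ffun 'I_k -> M}) (n : nat) :
  strat_repr H x h -> avoids H n (\sum_(j < k | (n <= j)%N) h j).
Proof.
case: n => [//|n] [_ _ hA]; have [nk | kn] := ltnP n.+1 k.
  exact/Apery_avoids/(hA (Ordinal nk)).
rewrite big_pred0; first exact: avoids0.
by move=> j; rewrite leqNgt (leq_trans (ltn_ord j) kn).
Qed.

(** Coprimality removes from [\sum t + y] one element of [t] at a time, and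
    every partial sum stays in [M_i]. *)
Lemma coprime_sum (i : 'I_k) (q y : M) (t : seq M) :
  (forall q', q' \in t -> coprime_in (tail_monoid H i) q q') ->
  (forall q', q' \in t -> H i q') -> tail_monoid H i y ->
  le_in (tail_monoid H i) q (\sum_(r <- t) r + y) ->
  le_in (tail_monoid H i) q y.
Proof.
have H_tail r : H i r -> tail_monoid H i r.
  by move=> Hr; apply: sub_gen; exists i => /=.
elim: t => [|q' t IHt] copr tH Ny; first by rewrite big_nil add0r.
rewrite big_cons -addrA addrC => q_le.
apply: IHt => // [r rt | r rt |]; [apply: copr | apply: tH |];
  rewrite ?in_cons ?rt ?orbT //.
apply: (copr q' (mem_head _ _)).2 => //.
apply: (gen_submonoid _).2 => //.
by apply: gen_sum => r rt; apply: H_tail; apply/tH/mem_behead.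
Qed.

(** Induction on [s].  An atom [q] of [s] is either cancelled against an
    occurrence in [t], or lies below [z] by [coprime_sum], which [avoids]
    excludes; once [s] is exhausted, an element left in [t] would lie below
    [y]. *)
Lemma cancel_sums (i : 'I_k) (s t : seq M) (y z : M) :
  (forall q q', H i q -> H i q' -> q <> q' ->
     coprime_in (tail_monoid H i) q q') ->
  (forall q, q \in s -> H i q) -> (forall q, q \in t -> H i q) ->
  avoids H i.+1 y -> avoids H i.+1 z ->
  \sum_(q <- s) q + y = \sum_(q <- t) q + z ->
  \sum_(q <- s) q = \sum_(q <- t) q.
Proof.
move=> copr.
have avoids_tail u : avoids H i.+1 u -> tail_monoid H i u.
  move=> uA; apply: avoids_tail_monoid => j q m ji; apply: uA.
  exact: ltnW.
elim: s t => [|q s IHs] t sH tH yA zA.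
  case: t tH => [//|q t] tH; rewrite big_nil add0r big_cons -addrA => yE.
  by case: (yA i q (\sum_(r <- t) r + z)) => //; apply/tH/mem_head.
have Hq : H i q by apply/sH/mem_head.
have {}sH r : r \in s -> H i r by move=> rs; apply: sH; rewrite inE rs orbT.
have [q_t | q_t] := boolP (q \in t).
  rewrite big_cons (big_rem q q_t) /= -!addrA => /cancelM eq_st.
  by congr (_ + _); apply: IHs => // r /mem_rem/tH.
rewrite big_cons -addrA => eq_st.
have [m _ zE] : le_in (tail_monoid H i) q z.
  apply: (@coprime_sum i q z t) => // [r rt||].
  - by apply: copr => //; [apply: tH | move=> qr; rewrite qr rt in q_t].
  - exact: avoids_tail.
  exists (\sum_(r <- s) r + y); last by rewrite eq_st.
  apply: (gen_submonoid _).2; last exact: avoids_tail.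
  by apply: gen_sum => r /sH Hr; apply: sub_gen; exists i => /=.
by case: (zA i q m).
Qed.

Lemma strat_repr_unique (x : M) (g h : {ffun 'I_k -> M}) :
  (forall (i : 'I_k) (q q' : M), H i q -> H i q' -> q <> q' ->
     coprime_in (tail_monoid H i) q q') ->
  strat_repr H x g -> strat_repr H x h -> g = h.
Proof.
move=> copr xg xh; have [xgE Hg _] := xg; have [xhE Hh _] := xh.
have step (i : 'I_k) :
    \sum_(j < k | (i <= j)%N) g j = \sum_(j < k | (i <= j)%N) h j -> g i = h i.
  rewrite !sum_tail.
  have [s sH ->] := gen_seq (Hg i); have [t tH ->] := gen_seq (Hh i).
  apply: (cancel_sums (copr i) sH tH).
    exact: (strat_repr_avoids (n := i.+1) xg).
  exact: (strat_repr_avoids (n := i.+1) xh).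
(* The tails agree by induction: equal heads are cancelled from equal tails. *)
have tails n : (n <= k)%N ->
    \sum_(j < k | (n <= j)%N) g j = \sum_(j < k | (n <= j)%N) h j.
  elim: n => [_|n IHn nk]; first by rewrite -xgE -xhE.
  have := IHn (ltnW nk); have := step (Ordinal nk) (IHn (ltnW nk)).
  rewrite (sum_tail g (Ordinal nk)) (sum_tail h (Ordinal nk)) => ->.
  exact: cancelM.
by apply/ffunP => i; apply/step/tails/ltnW/ltn_ord.
Qed.

End Strata.

Theorem theorem24 (M : nmodType) (k : nat) (H : 'I_k -> set M)
    (cancelM : cancellative M) (reducedM : reduced M)
    (atomicM : atomic [set: M]%classic) (stratH : stratification H) :
  (forall x : M, exists h : {ffun 'I_k -> M}, strat_repr H x h) /\
  ((forall (i : 'I_k) (q q' : M), H i q -> H i q' -> q <> q' ->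
      coprime_in (tail_monoid H i) q q') ->
   forall x : M, exists! h : {ffun 'I_k -> M}, strat_repr H x h).
Proof.
split=> [x | copr x]; first exact: strat_repr_exists.
have [h xh] := strat_repr_exists reducedM atomicM stratH x.
by exists h; split=> // g; apply: strat_repr_unique copr xh.
Qed.
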